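(* Let $G$ be a random graph (or random directed graph) on $n$ vertices with a pseudo-hamilton circuit (cycle) $H$. Then the probability that a pseudo-3-cycle is $H$-admissible is $$\frac{n-3}{2(n-2)}.$$
   Context: A pseudo-hamilton circuit is an $n$-cycle $H$ on the vertex set $\{1,\dots,n\}$ of $G$, whose arcs $(v,H(v))$ need not belong to $G$. The vertices are placed at equally spaced points of a circle, in the clockwise order given by $H$. A random pseudo-3-cycle $(a\ b\ c)$ is given by randomly choosing two arcs $(a,H(b))$ and $(b,H(c))$, neither of which is an arc of $H$. First the terminal vertex $H(b)$ is chosen uniformly among the $n-2$ vertices other than $a$ and $H(a)$, which determines $b$. Then the terminal vertex $H(c)$ is chosen uniformly among the $n-2$ vertices other than $b$ and $H(b)$. The pseudo-3-cycle is $H$-admissible exactly when the chords $(a,H(b))$ and $(b,H(c))$ properly intersect in the circle, i.e. they cross and have no endpoint in common. (This is the paper's criterion for $H(a\ b\ c)$ to be again an $n$-cycle.) *)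

(* Defs.v *)
From HB Require Import structures.
From mathcomp Require Import all_boot all_order all_algebra all_fingroup.
From mathcomp Require Import all_classical all_reals all_analysis.
Set Implicit Arguments.
Unset Strict Implicit.
Unset Printing Implicit Defensive.
Import Order.TTheory GRing.Theory Num.Theory.
Local Open Scope classical_set_scope.
Local Open Scope ring_scope.

Definition is_n_cycle n (h : 'S_n) : Prop :=
  forall v : 'I_n, porbit h v = [set: 'I_n]%SET.

(* The pictures obtained from different choices of [v0], the vertex drawn at
   (1, 0), differ by a rotation of the circle. The minus sign makes the order
   v0, h v0, h (h v0), ... clockwise. *)
Definition circle_point (R : realType) n (h : 'S_n) (v0 v : 'I_n) : R * R :=
  let theta := 2 * pi * (findex h v0 v)%:R / n%:R in
  (cos theta, - sin theta).

Definition open_segment (R : realType) (x y : R * R) : set (R * R) :=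
  [set (1 - t) *: x + t *: y | t in `]0, 1[%classic].

Definition properly_intersect (R : realType) (x y z t : R * R) : Prop :=
  [/\ x <> z, x <> t, y <> z & y <> t] /\
  open_segment x y `&` open_segment z t !=set0.

Definition H_admissible (R : realType) n (v0 : 'I_n) (h : 'S_n)
    (a b c : 'I_n) : Prop :=
  let pt := @circle_point R n h v0 in
  properly_intersect (pt a) (pt (h b)) (pt b) (pt (h c)).

Definition discrete_rv (d : measure_display) (T : measurableType d)
    (S : finType) (X : T -> S) : Prop :=
  forall x : S, measurable (X @^-1` [set x]).

(* Conditionally on X = x, the variable Y is uniform on A x; in product form,
   so that nothing is required at those x for which X = x has probability 0. *)
Definition uniform_given (d : measure_display) (T : measurableType d)
    (R : realType) (P : probability T R) (S S' : finType)
    (X : T -> S) (A : S -> {set S'}) (Y : T -> S') : Prop :=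
  forall (x : S) (y : S'),
    P (X @^-1` [set x] `&` Y @^-1` [set y]) =
    (P (X @^-1` [set x]) * ((y \in A x)%:R / #|A x|%:R)%:E)%E.

Definition random_digraph (d : measure_display) (T : measurableType d) n
    (G : T -> {set 'I_n * 'I_n}) : Prop :=
  discrete_rv G /\ forall w v, (v, v) \notin G w.

Definition random_graph (d : measure_display) (T : measurableType d) n
    (G : T -> {set 'I_n * 'I_n}) : Prop :=
  random_digraph G /\ forall w u v, ((u, v) \in G w) = ((v, u) \in G w).

(* The arcs of H need not belong to the graph. *)
Definition pseudo_hamilton (d : measure_display) (T : measurableType d) n
    (H : T -> 'S_n) : Prop :=
  discrete_rv H /\ forall w, is_n_cycle (H w).

(* The law of the initial vertex a is arbitrary. The variables drawn are the
   terminal vertices H(b) and H(c), which determine b and c. *)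
Definition random_pseudo_3_cycle (d : measure_display) (T : measurableType d)
    (R : realType) (P : probability T R) n
    (H : T -> 'S_n) (a b c : T -> 'I_n) : Prop :=
  [/\ discrete_rv a, discrete_rv b, discrete_rv c,
      uniform_given P
        (fun w => (H w, a w))
        (fun ha => ~: [set ha.2; ha.1 ha.2])%SET
        (fun w => H w (b w))
    & uniform_given P
        (fun w => (H w, a w, b w))
        (fun hab => ~: [set hab.2; hab.1.1 hab.2])%SET
        (fun w => H w (c w))].

(* Main.v *)
(* Number the vertices by their position along H, starting from a. If
   H(b) has position j, with 2 <= j <= n - 1, then b has position j - 1 and
   lies strictly inside the arc from a to H(b). Hence the chords (a, H(b)) and
   (b, H(c)) cross exactly when the position k of H(c) satisfies j < k < n.
   Among the (n - 2)^2 equally likely pairs (j, k), exactly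
   sum_j (n - 1 - j) = (n - 2)(n - 3) / 2 have this property.
   Crossing is read off from the signs of the determinants [orient]; on the
   circle these are products of sines of half the central angles. *)
Require Import Defs.
From mathcomp Require Import all_boot all_order all_algebra all_fingroup.
From mathcomp Require Import all_classical all_reals all_analysis.
From mathcomp Require Import ring lra zify.
Import Order.TTheory GRing.Theory Num.Theory.
Local Open Scope classical_set_scope.
Local Open Scope ring_scope.

(** * Orientation determinants and the crossing of segments in the plane *)

(** Twice the signed area of the triangle [x y z], negative for a clockwise triangle. *)
Definition orient {R : realType} (x y z : R * R) : R :=
  (y.1 - x.1) * (z.2 - x.2) - (y.2 - x.2) * (z.1 - x.1).

Lemma orient_cycle {R : realType} (x y z : R * R) : orient y z x = orient x y z.
Proof. by rewrite /orient; ring. Qed.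

Lemma orient_swap {R : realType} (x y z : R * R) :
  orient x z y = - orient x y z.
Proof. by rewrite /orient; ring. Qed.

Lemma orient_combination {R : realType} (x y z w : R * R) (t : R) :
  orient x y ((1 - t) *: z + t *: w) =
  (1 - t) * orient x y z + t * orient x y w.
Proof. by rewrite /orient /= /GRing.scale /=; ring. Qed.

Lemma orientxx {R : realType} (x y : R * R) : orient x x y = 0.
Proof. by rewrite /orient; ring. Qed.

Lemma orient_neq {R : realType} (x y z : R * R) : orient x y z != 0 ->
  [/\ x <> y, y <> z & x <> z].
Proof.
move=> o; split=> e; move: o; rewrite ?e.
- by rewrite orientxx eqxx.
- by rewrite -orient_cycle orientxx eqxx.
- by rewrite orient_swap orientxx oppr0 eqxx.
Qed.

(** The affine function [orient x y] keeps its nonzero sign along the segment from [z] to [w], but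
    it vanishes on the line through [x] and [y]. *)
Lemma open_segments_disjoint {R : realType} (x y z w : R * R) :
  0 < orient x y z * orient x y w ->
  ~ (open_segment x y `&` open_segment z w !=set0).
Proof.
move=> zw_same_side [_ [[u _ <-] [t /= + e]]].
rewrite in_itv /= => /andP[t0 t1].
have : orient x y ((1 - t) *: z + t *: w) = 0.
  by rewrite e orient_combination /orient; ring.
rewrite orient_combination => e'.
(* Multiplying by [orient x y z] covers both signs at once: the two summands become nonnegative and
   positive. *)
suff : (1 - t) * orient x y z ^+ 2 + t * (orient x y z * orient x y w) = 0.
  nra.
by rewrite -[RHS](mulr0 (orient x y z)) -e'; ring.
Qed.

(** The quotient is the zero of [(1 - t) * p + t * q], which changes sign between 0 and 1. *)
Lemma div_sub_itv01 {R : realType} (p q : R) : p * q < 0 ->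
  p / (p - q) \in `]0, 1[.
Proof.
move=> pq; rewrite in_itv /=.
have [q0|q0|q0] := ltrgt0P q; last by move: pq; rewrite q0; lra.
  have dl : p - q < 0 by nra.
  by rewrite ltr_ndivlMr // ltr_ndivrMr //; apply/andP; split; nra.
have dg : 0 < p - q by nra.
by rewrite ltr_pdivlMr // ltr_pdivrMr //; apply/andP; split; nra.
Qed.

Lemma open_segments_meet {R : realType} (x y z w : R * R) :
  orient x y z * orient x y w < 0 -> orient z w x * orient z w y < 0 ->
  open_segment x y `&` open_segment z w !=set0.
Proof.
set p := orient x y z; set q := orient x y w.
set p' := orient z w x; set q' := orient z w y => pq pq'.
have d0 : p - q != 0 by apply/eqP; nra.
have d0' : p' - q' != 0 by apply/eqP; nra.
(* The point of the segment from [x] to [y] at which [orient z w] vanishes, that is, where the two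
   lines meet. *)
exists ((1 - p' / (p' - q')) *: x + (p' / (p' - q')) *: y).
split; first by exists (p' / (p' - q')); rewrite //= div_sub_itv01.
exists (p / (p - q)); first by rewrite /= div_sub_itv01.
move: d0 d0'; rewrite /p /q /p' /q' /orient => d0 d0'.
by congr pair; rewrite /= /GRing.scale /=; field; rewrite d0 d0'.
Qed.

(** * Equally spaced points on the circle and their chords *)

(** The index [m] is not reduced modulo [n], so that positions can be shifted by addition. *)
Definition circ (R : realType) (n m : nat) : R * R :=
  let theta := 2 * pi * m%:R / n%:R in (cos theta, - sin theta).

Lemma orient_circle {R : realType} (x y z : R) :
  let pt t := (cos (2 * t), - sin (2 * t)) in
  orient (pt x) (pt y) (pt z) =
  - (4 * sin (y - x) * sin (z - x) * sin (z - y)).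
Proof.
have double t : (cos (2 * t) = 1 - 2 * sin t ^+ 2) *
                (sin (2 * t) = 2 * sin t * cos t).
  rewrite mulrDl !mul1r cosD sinD; split; last by ring.
  by have := cos2Dsin2 t; lra.
rewrite /orient /= !double !sinB.
ring: (sin2cos2 x) (sin2cos2 y) (sin2cos2 z).
Qed.

(** The three indices lie within one turn, so all half-angle differences are strictly between 0 and
    [pi] and the three sines are positive. *)
Lemma orient_circ {R : realType} (n p q r : nat) : (p < q < r)%N ->
  (r < p + n)%N -> orient (circ R n p) (circ R n q) (circ R n r) < 0.
Proof.
move=> /andP[pq qr] rpn.
have n0 : (0 < n%:R :> R) by rewrite ltr0n; lia.
have circE m : circ R n m =
    (cos (2 * (pi * m%:R / n%:R)), - sin (2 * (pi * m%:R / n%:R))).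
  by rewrite /circ !mulrA.
have sin_gt0 u v : (u < v)%N -> (v < u + n)%N ->
    0 < sin (pi * v%:R / n%:R - pi * u%:R / n%:R :> R).
  move=> uv vun; apply: sin_gt0_pi.
  rewrite -mulrBl -mulrBr -natrB 1?ltnW // -mulrA.
  rewrite pmulr_rgt0 ?pi_gt0 // divr_gt0 // ?ltr0n ?subn_gt0 //.
  by rewrite gtr_pMr ?pi_gt0 // ltr_pdivrMr // mul1r ltr_nat; lia.
rewrite !circE orient_circle oppr_lt0.
by rewrite !mulr_gt0 //; apply: sin_gt0; lia.
Qed.

(** The clockwise order is [p], [p + j.-1], [p + j], [p + k], so the endpoints of the two chords
    alternate. *)
Lemma circ_crossing {R : realType} (n p j k : nat) : (1 < j < k)%N ->
  (k < n)%N ->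
  properly_intersect (circ R n p) (circ R n (p + j))
                     (circ R n (p + j.-1)) (circ R n (p + k)).
Proof.
move=> jk kn; have o u v w : (u < v < w)%N -> (w < n)%N ->
    orient (circ R n (p + u)) (circ R n (p + v)) (circ R n (p + w)) < 0.
  by move=> uvw wn; apply: orient_circ; lia.
rewrite -{1}(addn0 p).
have o1 := o 0 j k ltac:(lia) ltac:(lia).
have o2 := o 0 j.-1 j ltac:(lia) ltac:(lia).
have o3 := o 0 j.-1 k ltac:(lia) ltac:(lia).
have o4 := o j.-1 j k ltac:(lia) ltac:(lia).
split.
  (* A nonzero determinant forces its three points to be pairwise distinct. *)
  have [_ yt xt] := orient_neq _ _ _ (ltr0_neq0 o1).
  have [xz zy _] := orient_neq _ _ _ (ltr0_neq0 o2).
  by split=> //; apply: nesym.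
apply: open_segments_meet.
  by rewrite orient_swap pmulr_rlt0 // oppr_gt0.
rewrite orient_cycle (orient_swap (circ R n (p + j.-1))).
by rewrite nmulr_rlt0 // oppr_gt0.
Qed.

(** For [k = 0] the chords share an endpoint. Otherwise [p + j.-1] and [p + k] both lie strictly
    inside the arc from [p] to [p + j], on one side of the first chord. *)
Lemma circ_noncrossing {R : realType} (n p j k : nat) : (k < j < n)%N ->
  k != j.-1 ->
  ~ properly_intersect (circ R n p) (circ R n (p + j))
                       (circ R n (p + j.-1)) (circ R n (p + k)).
Proof.
move=> kjn kj [[_ xt _ _]].
have [k0|k0] := posnP k; first by rewrite k0 addn0 in xt.
have o u v w : (u < v < w)%N -> (w < n)%N ->
    orient (circ R n (p + u)) (circ R n (p + v)) (circ R n (p + w)) < 0.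
  by move=> uvw wn; apply: orient_circ; lia.
apply: open_segments_disjoint; rewrite -{1 4}(addn0 p).
rewrite (orient_swap _ (circ R n (p + j.-1))).
rewrite (orient_swap _ (circ R n (p + k))).
by rewrite mulrNN nmulr_rgt0 o //; lia.
Qed.

(** * Positions along an n-cycle *)

Lemma n_cycle_fconnect {n : nat} {h : 'S_n} (hcyc : is_n_cycle h)
  (u v : 'I_n) : fconnect h u v.
Proof.
have : v \in porbit h u by rewrite hcyc inE.
by case/porbitP => i ->; rewrite permX; apply: fconnect_iter.
Qed.

Lemma n_cycle_order {n : nat} {h : 'S_n} (hcyc : is_n_cycle h)
  (v : 'I_n) : fingraph.order h v = n.
Proof.
rewrite /fingraph.order -[RHS]card_ord; apply: eq_card => u.
by rewrite !inE; exact: (n_cycle_fconnect hcyc).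
Qed.

Lemma n_cycle_iter_eq {n : nat} {h : 'S_n} (hcyc : is_n_cycle h)
  (v : 'I_n) (i j : nat) : (i < n)%N -> (j < n)%N ->
  (iter i h v == iter j h v) = (i == j).
Proof.
move=> i_n j_n; apply/eqP/eqP => [e|->//].
by rewrite -(@findex_iter _ h v i) ?(n_cycle_order hcyc) // e
  findex_iter ?(n_cycle_order hcyc).
Qed.

(** [findex] returns [m] modulo [n], which changes the angle only by a multiple of [2 * pi]. *)
Lemma circle_point_iter {R : realType} {n : nat} {h : 'S_n}
  (hcyc : is_n_cycle h) (v0 : 'I_n) (m : nat) :
  circle_point R h v0 (iter m h v0) = circ R n m.
Proof.
have n0 : (0 < n)%N by apply: leq_ltn_trans (ltn_ord v0).
have -> : iter m h v0 = iter (m %% n) h v0.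
  rewrite [in LHS](divn_eq m n) addnC iterD; congr (iter _ _ _).
  elim: (m %/ n)%N => [|q IH]; first by [].
  rewrite mulSn iterD IH -[X in iter X _ _](n_cycle_order hcyc v0).
  by rewrite iter_order //; exact: perm_inj.
rewrite /circle_point findex_iter ?(n_cycle_order hcyc) ?ltn_pmod //.
rewrite /circ [in RHS](divn_eq m n).
have -> : 2 * pi * (m %/ n * n + m %% n)%N%:R / n%:R =
    2 * pi * (m %% n)%:R / n%:R + pi *+ 2 *+ (m %/ n) :> R.
  rewrite natrD natrM -(mulr_natr _ (m %/ n)) -(mulr_natr pi 2); field.
  by rewrite pnatr_eq0 -lt0n.
by rewrite (periodicn (@cosD2pi R)) (periodicn (@sinD2pi R)).
Qed.

Lemma H_admissible_iter {R : realType} {n : nat} {h : 'S_n}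
  (hcyc : is_n_cycle h) (v0 x : 'I_n) (j k : nat) :
  (1 < j < n)%N -> (k < n)%N -> k != j.-1 -> k != j ->
  H_admissible R v0 h x (iter j.-1 h x) (h^-1 (iter k h x))%g <-> (j < k)%N.
Proof.
move=> jn kn kj1 kj; rewrite /H_admissible permKV -iterS prednK; last lia.
(* Starting from [x] instead of [v0] shifts all positions by the same [p]. *)
have [p ->] : exists p, x = iter p h v0.
  exists (findex h v0 x); rewrite iter_findex //.
  exact: (n_cycle_fconnect hcyc).
rewrite -!iterD !(circle_point_iter hcyc) ![(_ + p)%N]addnC.
split=> [|jk]; last by apply: circ_crossing => //; lia.
case: (ltnP j k) => // kj'; apply: contraPP => _.
by apply: circ_noncrossing; lia.
Qed.

(** * Counting the admissible pairs of terminal vertices *)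

Lemma sum_between (n k : nat) : (\sum_(j < n) (1 < j < k))%N = (minn n k - 2)%N.
Proof.
by elim: n => [|n IH]; rewrite ?big_ord0 ?min0n // big_ord_recr /= IH; lia.
Qed.

Lemma sum_crossing_pairs (n : nat) : (2 < n)%N ->
  ((\sum_(j < n) \sum_(k < n) (1 < j < k)) * 2 = (n - 2) * (n - 3))%N.
Proof.
(* With [k] fixed, the inner sum over [j] is [k - 2], truncated at 0. *)
rewrite exchange_big /=; under eq_bigr => k _ do
  rewrite sum_between (minn_idPr (ltnW (ltn_ord k))).
(* The induction effectively starts at 3 vertices, where both sides are 0. *)
elim: n => [//|n IH]; rewrite leq_eqVlt big_ord_recr /= => /predU1P[[<-]|n2].
  by rewrite !big_ord_recr big_ord0.
by have := IH n2; nia.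
Qed.

Lemma count_admissible {R : realType} (n : nat) (h : 'S_n) (v0 x : 'I_n) :
  (2 < n)%N -> is_n_cycle h ->
  ((\sum_y \sum_z ([&& y \in ~: [set x; h x],
       z \in ~: [set (h^-1) y; y] &
       `[< H_admissible R v0 h x ((h^-1) y) ((h^-1) z) >]])) * 2 =
  (n - 2) * (n - 3))%N%g.
Proof.
move=> n2 hcyc.
(* Both terminal vertices are replaced by their positions [j] and [k] counted from [x]. *)
have bij : bijective (fun j : 'I_n => iter j h x).
  apply: injF_bij => i j /eqP; rewrite (n_cycle_iter_eq hcyc) // => /eqP.
  exact: val_inj.
rewrite -(sum_crossing_pairs _ n2); congr (_ * _)%N.
rewrite (reindex _ (onW_bij _ bij)); apply: eq_bigr => j _.
rewrite (reindex _ (onW_bij _ bij)); apply: eq_bigr => k _.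
congr nat_of_bool; rewrite !inE /=.
(* The excluded vertices [x] and [h x] have positions 0 and 1. *)
rewrite (n_cycle_iter_eq hcyc x j 0) ?(n_cycle_iter_eq hcyc x j 1) //; try lia.
have [j1|j1] := leqP j 1; first by case: (nat_of_ord j) j1 => [|[]].
have -> : (h^-1)%g (iter j h x) = iter j.-1 h x.
  by case: (nat_of_ord j) j1 => // i _; rewrite iterS permK.
have lj := ltn_ord j.
rewrite !(n_cycle_iter_eq hcyc) //; last lia.
(* Positions [j.-1] and [j] are those excluded for the second terminal vertex; neither satisfies
   [j < k]. *)
case: (eqVneq (k : nat) j.-1) => [->|kj1]; first lia.
case: (eqVneq (k : nat) j) => [->|kj]; first lia.
have j1n : (1 < j < n)%N by lia.
have adm := @H_admissible_iter R n h hcyc v0 x j k j1n (ltn_ord k) kj1 kj.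
rewrite (asbool_equiv_eq adm) asboolb; lia.
Qed.

(** * Random variables with finitely many values *)

Lemma discrete_rv_pair d (T : measurableType d) (S S' : finType)
    (X : T -> S) (Y : T -> S') :
  discrete_rv X -> discrete_rv Y -> discrete_rv (fun w => (X w, Y w)).
Proof.
move=> mX mY [x y].
have -> : (fun w => (X w, Y w)) @^-1` [set (x, y)] =
    X @^-1` [set x] `&` Y @^-1` [set y].
  by apply/seteqP; split=> w /=; [case=> -> -> | case=> -> ->].
exact: measurableI.
Qed.

Lemma preimage_bigcup_fibers (T S : Type) (X : T -> S) (D : set S) :
  X @^-1` D = \bigcup_(s in D) X @^-1` [set s].
Proof.
by apply/seteqP; split=> [w Dw|w [s Ds /= ->]//]; exists (X w).
Qed.

Lemma discrete_rv_preimage d (T : measurableType d) (S : finType) (X : T -> S)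
    (D : set S) : discrete_rv X -> measurable (X @^-1` D).
Proof.
move=> mX; rewrite preimage_bigcup_fibers.
by apply: fin_bigcup_measurable => // s _; apply: mX.
Qed.

Lemma discrete_rv_comp d (T : measurableType d) (S S' : finType) (X : T -> S)
    (f : S -> S') : discrete_rv X -> discrete_rv (f \o X).
Proof. by move=> mX s; rewrite comp_preimage; apply: discrete_rv_preimage. Qed.

Lemma measure_preimage_discrete_rv d (T : measurableType d) (R : realType)
    (P : probability T R) (S : finType) (X : T -> S) (D : set S) :
  discrete_rv X ->
  P (X @^-1` D) = (\sum_(s | `[< D s >]) P (X @^-1` [set s]))%E.
Proof.
move=> mX; rewrite preimage_bigcup_fibers measure_fin_bigcup; last first.
- by move=> s _; exact: mX.
- by move=> s t _ _ [w [/= <- <-]].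
- exact: finite_finset.
rewrite fsbig_finite //= big_uniq //=.
  by apply: eq_bigl => s; rewrite in_fset_set //; exact: finite_finset.
exact: finmap.fset_uniq.
Qed.

(** * Total probability over the cycle and the initial vertex *)

Theorem theorem1p1 (R : realType) (d : measure_display) (T : measurableType d)
  (P : probability T R) (n : nat) (hn : (3 <= n)%N)
  (G : T -> {set 'I_n * 'I_n}) (hG : random_graph G \/ random_digraph G)
  (H : T -> 'S_n) (hH : pseudo_hamilton H)
  (a b c : T -> 'I_n) (habc : random_pseudo_3_cycle P H a b c)
  (v0 : 'I_n) :
  P [set w | H_admissible R v0 (H w) (a w) (b w) (c w)] =
  ((n%:R - 3) / (2 * (n%:R - 2)))%:E.
Proof.
case: hH => mH Hcyc; case: habc => ma mb mc unifb unifc.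
pose U w := (H w, a w).
(* Admissibility is a function of [W], since [b] and [c] are recovered from the terminal vertices by
   the inverse of [H]. *)
pose W w := (U w, (H w (b w), H w (c w))).
have mU : discrete_rv U by apply: discrete_rv_pair.
have mHv (v : T -> 'I_n) : discrete_rv v -> discrete_rv (fun w => H w (v w)).
  move=> mv; exact: (discrete_rv_comp _ _ _ _ _
    (fun hv : 'S_n * 'I_n => hv.1 hv.2)
    (discrete_rv_pair _ _ _ _ _ _ mH mv)).
have mW : discrete_rv W.
  by do 2?[apply: discrete_rv_pair => //]; exact: mHv.
pose adm (s : ('S_n * 'I_n) * ('I_n * 'I_n)) :=
  H_admissible R v0 s.1.1 s.1.2 (s.1.1^-1 s.2.1)%g (s.1.1^-1 s.2.2)%g.
have -> : [set w | H_admissible R v0 (H w) (a w) (b w) (c w)] =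
    W @^-1` [set s | adm s].
  by apply/seteqP; split=> w; rewrite /adm /= !permK.
rewrite measure_preimage_discrete_rv //.
pose p u := fine (P (U @^-1` [set u])).
have pE u : P (U @^-1` [set u]) = (p u)%:E.
  by rewrite fineK // fin_num_measure //; exact: mU.
pose A (u : 'S_n * 'I_n) : {set 'I_n} := (~: [set u.2; u.1 u.2])%SET.
pose B (u : 'S_n * 'I_n) (y : 'I_n) : {set 'I_n} :=
  (~: [set (u.1^-1)%g y; y])%SET.
(* Chain rule: given [H], knowing [b] amounts to knowing the terminal vertex [y], so the two uniform
   laws multiply. *)
have PW u y z : P (W @^-1` [set (u, (y, z))]) =
    (p u * ((y \in A u)%:R / #|A u|%:R) * ((z \in B u y)%:R / #|B u y|%:R))%:E.
  case: u => h x; have := unifc (h, x, (h^-1)%g y) z.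
  have -> : (fun w => (H w, a w, b w)) @^-1` [set (h, x, (h^-1)%g y)] =
      U @^-1` [set (h, x)] `&` (fun w => H w (b w)) @^-1` [set y].
    apply/seteqP; split=> w /=; rewrite /U.
      by case=> -> -> ->; rewrite permKV.
    by case=> [[-> ->] <-]; rewrite permK.
  rewrite unifb pE /= permKV -!EFinM => <-.
  by congr (P _); apply/seteqP; split=> w /=; rewrite /W /U;
    [case=> -> -> -> -> | case=> [[[-> ->] ->] ->]].
have psum : (\sum_u p u = 1)%R.
  apply: EFin_inj; rewrite -sumEFin -(probability_setT P).
  rewrite -(preimage_setT U) measure_preimage_discrete_rv //.
  by apply: eq_big => [u|u _]; [rewrite asboolT | rewrite pE].
(* The target is written as an average over [U], so that the claim can be checked for each value of
   [U] separately. *)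
transitivity (\sum_u (p u * ((n%:R - 3) / (2 * (n%:R - 2))))%:E)%E; last first.
  by rewrite sumEFin -mulr_suml psum mul1r.
pose F u v := if `[< adm (u, v) >] then P (W @^-1` [set (u, v)]) else 0%E.
rewrite big_mkcond (eq_bigr (fun s => F s.1 s.2)); last by case.
rewrite -(pair_bigA _ F) /F.
apply: eq_bigr => -[h x] _.
(* A permutation that is not an n-cycle has weight 0 on both sides. *)
have [hcyc|hNcyc] := pselect (is_n_cycle h); last first.
  have p0 : p (h, x) = 0.
    rewrite /p (_ : _ @^-1` _ = set0) ?measure0 //.
    by apply/seteqP; split=> w //= -[Hw _]; apply: hNcyc; rewrite -Hw.
  rewrite p0 mul0r big1 // => -[y z] _.
  by case: ifP => // _; rewrite PW p0 !mul0r.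
have cardA (v : 'I_n) : #|~: [set v; h v]| = (n - 2)%N.
  have vhv : v != h v.
    have := n_cycle_iter_eq hcyc v 0 1 (ltnW (ltnW hn)) (ltnW hn).
    by move=> /= ->.
  by rewrite cardsCs finset.setCK cards2 vhv card_ord.
have cardB y : #|B (h, x) y| = (n - 2)%N.
  by have := cardA ((h^-1)%g y); rewrite permKV.
have n2 : (n - 2)%N%:R = n%:R - 2 :> R by rewrite natrB // ltnW.
have n3 : (n - 3)%N%:R = n%:R - 3 :> R by rewrite natrB.
have n2_neq0 : n%:R - 2 != 0 :> R by rewrite -n2 pnatr_eq0 subn_eq0 -ltnNge.
have /(congr1 (fun m => m%:R : R)) := @count_admissible R n h v0 x hn hcyc.
rewrite pair_bigA /= !natrM n2 n3 natr_sum => count.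
(* Each allowed pair has the same weight [p (h, x) / (n%:R - 2) ^+ 2], which reduces the sum to the
   count of admissible pairs. *)
rewrite (eq_bigr (fun v => (p (h, x) / (n%:R - 2) ^+ 2 *
  [&& v.1 \in A (h, x), v.2 \in B (h, x) v.1 &
      `[< adm (h, x, v) >]]%:R)%:E)).
  rewrite sumEFin -mulr_sumr; congr _%:E.
  apply: (mulIf (_ : 2 != 0)); first by rewrite pnatr_eq0.
  rewrite -mulrA [X in _ * X = _]count; field.
  by rewrite n2_neq0.
move=> [y z] _; rewrite PW cardA cardB n2 /=; case: (`[< _ >]).
  by rewrite andbT; congr _%:E; case: (y \in _); case: (z \in _) => /=; field.
by rewrite !andbF mulr0.
Qed.
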